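(* Let $\langle\Sigma,\tau\rangle$ be a transition system with $\widetilde{\mathrm{pre}}$ computable, let $L\subseteq\wp(\Sigma)$ be closed under arbitrary intersections and arbitrary unions and such that $\langle\Sigma,\sqsubseteq_L\rangle$ is a well-quasiordered set, and let $\Sigma_0,P\in\wp(\Sigma)$. Consider the following procedure: set $I_1:=\Sigma$; while $\Sigma_0\subseteq I_1$: if $I_1=\hat\mu_L(\widetilde{\mathrm{pre}}(I_1)\cap I_1\cap P)$, return $I_1$; otherwise set $I_1:=I_1\cap\hat\mu_L(\widetilde{\mathrm{pre}}(I_1)\cap I_1\cap P)$; after the loop, return ''no inductive invariant in $L$''. This procedure is terminating and correct: if it returns a set $I_1$ then $I_1\in L$ is an inductive invariant for $\langle\Sigma_0,P\rangle$, and if it returns ''no inductive invariant in $L$'' then no element of $L$ is an inductive invariant for $\langle\Sigma_0,P\rangle$. Furthermore, if it returns $I_1$ then $I_1$ is the greatest (with respect to $\subseteq$) inductive invariant in $L$ for $\langle\Sigma_0,P\rangle$.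
   Context: For $X\subseteq\Sigma$: $\mathrm{post}(X)=\{s'\mid\exists s\in X.\ (s,s')\in\tau\}$ and $\widetilde{\mathrm{pre}}(X)=\{s\mid\forall s'.\ (s,s')\in\tau\Rightarrow s'\in X\}$. $s\sqsubseteq_L s'$ iff for all $\phi\in L$, $s'\in\phi$ implies $s\in\phi$. A quasiordered set $D_\leq$ is well-quasiordered if every infinite sequence $(x_i)_{i\in\mathbb{N}}$ in $D$ has indices $i<j$ with $x_i\leq x_j$. $\hat\mu_L(X)=\bigcup\{\phi\in L\mid\phi\subseteq X\}$. Closure under arbitrary intersections and unions includes the empty ones. An inductive invariant for $\langle\Sigma_0,P\rangle$ is a set $I\subseteq\Sigma$ with $\Sigma_0\subseteq I$, $\mathrm{post}(I)\subseteq I$ and $I\subseteq P$. Termination means that the loop is executed finitely many times. *)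

(* Defs.v *)
From mathcomp Require Import all_boot.
From mathcomp Require Import boolp classical_sets.

Set Implicit Arguments.
Unset Strict Implicit.
Unset Printing Implicit Defensive.

Local Open Scope classical_set_scope.

(* Total recursive functions: minimization is only allowed when the function
   minimized has a zero for every value of the parameters. *)
Inductive recursive : forall k, (k.-tuple nat -> nat) -> Prop :=
| rec_zero k : recursive (fun _ : k.-tuple nat => 0)
| rec_succ : recursive (fun x : 1.-tuple nat => (thead x).+1)
| rec_proj k (i : 'I_k) : recursive (fun x : k.-tuple nat => tnth x i)
| rec_comp k m (f : m.-tuple nat -> nat) (g : 'I_m -> k.-tuple nat -> nat) :
    recursive f -> (forall i, recursive (g i)) ->
    recursive (fun x : k.-tuple nat => f [tuple g i x | i < m])
| rec_prim k (f : k.-tuple nat -> nat) (g : k.+2.-tuple nat -> nat) :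
    recursive f -> recursive g ->
    recursive (fun x : k.+1.-tuple nat =>
      nat_rect (fun=> nat) (f [tuple of behead x])
        (fun n r => g [tuple of n :: r :: behead x]) (thead x))
| rec_min k (f : k.+1.-tuple nat -> nat)
    (ex0 : forall x : k.-tuple nat, exists y, f [tuple of y :: x] == 0) :
    recursive f ->
    recursive (fun x : k.-tuple nat => ex_minn (ex0 x)).

(* [F] is computable on the sets represented by [nu], where [nu n] is the set
   denoted by the finite description with code [n]: a recursive function
   turns every description of [X] into a description of [F X]. *)
Definition computable_wrt (T : Type) (nu : nat -> set T)
    (F : set T -> set T) : Prop :=
  exists f : nat -> nat,
    recursive (fun x : 1.-tuple nat => f (thead x)) /\
    forall n, F (nu n) = nu (f n).

Definition well_quasiordered (D : Type) (le : D -> D -> Prop) : Prop :=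
  [/\ forall x, le x x,
      forall x y z, le x y -> le y z -> le x z &
      forall x : nat -> D, exists i j, (i < j)%N /\ le (x i) (x j)].

Section TransitionSystem.
Variables (Sigma : Type) (tau : set (Sigma * Sigma)).
Implicit Types (X I P : set Sigma) (L : set (set Sigma)).

Definition post X : set Sigma := [set s' | exists2 s, X s & tau (s, s')].

Definition pre_tilde X : set Sigma := [set s | forall s', tau (s, s') -> X s'].

Definition inductive_invariant (Sigma0 : set Sigma) P I : Prop :=
  [/\ Sigma0 `<=` I, post I `<=` I & I `<=` P].

Definition qo_of L (s s' : Sigma) : Prop := forall phi, L phi -> phi s' -> phi s.

(* The empty families are included, so that these give [setT \in L] and
   [set0 \in L] respectively. *)
Definition bigcap_closed L : Prop :=
  forall F : set (set Sigma), F `<=` L -> L (\bigcap_(phi in F) phi).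
Definition bigcup_closed L : Prop :=
  forall F : set (set Sigma), F `<=` L -> L (\bigcup_(phi in F) phi).

Definition mu_hat L X : set Sigma :=
  \bigcup_(phi in [set phi | L phi /\ phi `<=` X]) phi.

Inductive outcome := Invariant of set Sigma | NoInvariant.

(* [Running I1] is the control point at the head of the while loop with current
   value [I1] of the program variable. *)
Inductive config := Running of set Sigma | Returned of outcome.

Definition step L (Sigma0 : set Sigma) P (c : config) : config :=
  match c with
  | Running I1 =>
      let J := mu_hat L (pre_tilde I1 `&` I1 `&` P) in
      if `[< Sigma0 `<=` I1 >] then
        if `[< I1 = J >] then Returned (Invariant I1) else Running (I1 `&` J)
      else Returned NoInvariant
  | Returned o => Returned o
  end.

Definition run L (Sigma0 : set Sigma) P (n : nat) : config :=
  iter n (step L Sigma0 P) (Running setT).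

Definition returns L (Sigma0 : set Sigma) P (o : outcome) : Prop :=
  exists n, run L Sigma0 P n = Returned o.

Definition terminates L (Sigma0 : set Sigma) P : Prop :=
  exists o, returns L Sigma0 P o.

Definition greatest_invariant_in L (Sigma0 : set Sigma) P I : Prop :=
  [/\ L I, inductive_invariant Sigma0 P I &
      forall J, L J -> inductive_invariant Sigma0 P J -> J `<=` I].

End TransitionSystem.

Arguments NoInvariant {Sigma}.

(* Main.v *)
Require Import Defs.
From mathcomp Require Import all_boot.
From mathcomp Require Import boolp classical_sets.

Set Implicit Arguments.
Unset Strict Implicit.
Unset Printing Implicit Defensive.

Local Open Scope classical_set_scope.

(* Termination is the descending chain condition: a strict chain [D] in [L]
   would give points [x n] in [D n] outside [D n.+1], and [qo_of L (x i) (x j)]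
   with [i < j] would put [x i] in [D i.+1], which contains [D j]. The iterates
   of the procedure stay in [L] and above every inductive invariant in [L], so
   an iterate that is a fixpoint is the greatest one, and an iterate that
   misses part of [Sigma0] excludes all of them. *)

Lemma wqo_no_strict_descending_chain (T : Type) (L : set (set T))
    (D : nat -> set T) :
  well_quasiordered (qo_of L) -> (forall n, L (D n)) ->
  (forall n, D n.+1 `<` D n) -> False.
Proof.
move=> [_ _ wqoL] LD Dlt.
have /choice[x Dx] n : exists y, D n y /\ ~ D n.+1 y.
  by have [_ /nonsubset[y]] := Dlt n; exists y.
have [i [j [ltij le_ij]]] := wqoL x.
have Dsub k : D (i.+1 + k) `<=` D i.+1.
  elim: k => [|k IHk]; first by rewrite addn0.
  by rewrite addnS; apply: subset_trans (Dlt _).1 IHk.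
(* The set tested is [D i.+1]; as [i < j], the index [j] is [i.+1 + (j - i.+1)]. *)
apply: (Dx i).2; apply: le_ij (LD _) (Dsub (j - i.+1) _ _).
by rewrite subnKC //; exact: (Dx j).1.
Qed.

Section Procedure.
Variables (Sigma : Type) (tau : set (Sigma * Sigma)) (L : set (set Sigma)).
Variables (Sigma0 P : set Sigma).
Hypotheses (L_bigcap : bigcap_closed L) (L_bigcup : bigcup_closed L).

Lemma mu_hat_in X : L (mu_hat L X).
Proof. by apply: L_bigcup => phi []. Qed.

Lemma mu_hat_sub X : mu_hat L X `<=` X.
Proof. by move=> s [phi [_ sub_phi]] /sub_phi. Qed.

Lemma sub_mu_hat X phi : L phi -> phi `<=` X -> phi `<=` mu_hat L X.
Proof. by move=> Lphi sub_phi s phi_s; exists phi. Qed.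

Definition iterand I := mu_hat L (pre_tilde tau I `&` I `&` P).

Lemma iterand_sub I : iterand I `<=` I.
Proof. by move=> s /mu_hat_sub[[]]. Qed.

(** Closure under [post] puts [J] inside [pre_tilde tau J], and [pre_tilde] is monotone; so [J] is
    one of the members of [L] whose union is [iterand I]. *)
Lemma invariant_sub_iterand I J :
  L J -> inductive_invariant tau Sigma0 P J -> J `<=` I -> J `<=` iterand I.
Proof.
move=> LJ [_ postJ JP] JI; apply: sub_mu_hat => // s Js.
split; last exact: JP.
by split=> [s' tau_ss'|]; apply: JI => //; apply: postJ; exists s.
Qed.

Lemma iterand_fixpoint I :
  Sigma0 `<=` I -> I = iterand I -> inductive_invariant tau Sigma0 P I.
Proof.
move=> Sigma0I fixI.
have subI : I `<=` pre_tilde tau I `&` I `&` P.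
  by rewrite {1}fixI; exact: mu_hat_sub.
split=> //; last by move=> s /subI[].
by move=> s' [s /subI[[+ _] _]]; apply.
Qed.

(** The loop invariant, extended to final configurations by the guarantee of each answer, so that
    one induction on the number of steps gives partial correctness. *)
Definition sound (c : config Sigma) : Prop :=
  match c with
  | Running I1 => L I1 /\
      forall J, L J -> inductive_invariant tau Sigma0 P J -> J `<=` I1
  | Returned (Invariant I1) => greatest_invariant_in tau L Sigma0 P I1
  | Returned NoInvariant =>
      forall J, L J -> ~ inductive_invariant tau Sigma0 P J
  end.

Lemma step_sound c : sound c -> sound (step tau L Sigma0 P c).
Proof.
case: c => [I|//] [LI maxI] /=; case: asboolP => [Sigma0I|nSigma0I].
  case: asboolP => [fixI|_]; first by split=> //; exact: iterand_fixpoint.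
  (* The new value is [iterand I] itself, a union of members of [L]. *)
  rewrite setIidr; last exact: iterand_sub.
  split=> [|J LJ invJ]; first exact: mu_hat_in.
  by apply: invariant_sub_iterand => //; exact: maxI.
move=> J LJ invJ; apply: nSigma0I.
by case: (invJ) => Sigma0J _ _; apply: subset_trans Sigma0J (maxI _ LJ invJ).
Qed.

Lemma run_sound n : sound (run tau L Sigma0 P n).
Proof.
elim: n => [|n IHn]; last exact: step_sound.
(* The initial value [setT] is the intersection of the empty family. *)
by split=> //; rewrite -(bigcap_set0 id); apply: L_bigcap.
Qed.

Lemma wqo_terminates :
  well_quasiordered (qo_of L) -> terminates tau L Sigma0 P.
Proof.
move=> wqoL; apply: contrapT => nterm.
(* Without an outcome every configuration is [Running]; [D] collects the values. *)
have /choice[D runD] n : exists I, run tau L Sigma0 P n = Running I.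
  case run_n: (run tau L Sigma0 P n) => [I|o]; first by exists I.
  by case: nterm; exists o, n.
apply: (wqo_no_strict_descending_chain (D := D) wqoL) => n.
  by have := run_sound n; rewrite runD => -[].
(* As step [n] does not return, the fixpoint test fails at [D n], which makes the inclusion
   strict. *)
have := runD n.+1; rewrite /run iterS -/(run _ _ _ _ _) runD /=.
case: asboolP => // _; case: asboolP => // nfix [<-].
rewrite setIidr; last exact: iterand_sub.
split; first exact: iterand_sub.
by move=> sub; apply: nfix; apply/seteqP; split=> //; exact: iterand_sub.
Qed.

End Procedure.

Theorem mainTheorem12 (Sigma : Type) (tau : set (Sigma * Sigma))
    (nu : nat -> set Sigma) (L : set (set Sigma)) (Sigma0 P : set Sigma)
    (pre_computable : computable_wrt nu (pre_tilde tau))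
    (L_bigcap : bigcap_closed L)
    (L_bigcup : bigcup_closed L)
    (L_wqo : well_quasiordered (qo_of L)) :
  [/\ terminates tau L Sigma0 P,
      forall I1, returns tau L Sigma0 P (Invariant I1) ->
        L I1 /\ inductive_invariant tau Sigma0 P I1,
      returns tau L Sigma0 P NoInvariant ->
        forall I, L I -> ~ inductive_invariant tau Sigma0 P I &
      forall I1, returns tau L Sigma0 P (Invariant I1) ->
        greatest_invariant_in tau L Sigma0 P I1].
Proof.
have sound_returns o :
    returns tau L Sigma0 P o -> sound tau L Sigma0 P (Returned o).
  by move=> [n <-]; exact: run_sound.
split; first exact: wqo_terminates.
- by move=> I1 /sound_returns[].
- exact: sound_returns.
- by move=> I1 /sound_returns.
Qed.
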